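(* Let $T_5(n)=(5n+1)/2$ for odd $n$ and $T_5(n)=n/2$ for even $n$. For an integer $n$ let $t^-(n)=\inf\{|T_5^{(k)}(n)|:k\ge0\}$. Then $$\liminf_{n\to\infty}\frac{\log t^-(n)}{\log n}=0 .$$
   Context: $T_5^{(k)}$ denotes the $k$-th iterate of $T_5$ (with $T_5^{(0)}(n)=n$); the liminf is over positive integers $n\to\infty$. *)

(* Defs.v *)
From Stdlib Require Import ZArith Reals.
From Coquelicot Require Import Coquelicot.

(* Both divisions are exact, on negative integers too. *)
Definition T5 (n : Z) : Z :=
  if Z.odd n then ((5 * n + 1) / 2)%Z else (n / 2)%Z.

(* [Inf_seq] is never infinite here: the set is nonempty and bounded below
   by 0, so [real] only removes the [Finite] constructor. *)
Definition tminus (n : Z) : R :=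
  real (Inf_seq (fun k : nat => IZR (Z.abs (Nat.iter k T5 n)))).

(* Main.v *)
Require Import Defs.
From Stdlib Require Import ZArith Reals Lia Lra.
From Coquelicot Require Import Coquelicot.

(** Positive integers stay positive under [T5], so [tminus n >= 1] for [n > 0]
    and the quotient is nonnegative; it vanishes at the powers of 2, whose
    orbits reach 1. *)

(** The lower bound on the liminf is [tminus_ge1]: both logarithms are of the right sign as soon as
    n >= 2. The upper bound is [tminus_pow2]: k halvings take 2^k to 1, the least value allowed, so
    the quotient is exactly 0 at arbitrarily large n. *)

Lemma T5_pos (n : Z) : (0 < n)%Z -> (0 < T5 n)%Z.
Proof.
  intros Hn; unfold T5; destruct (Z.odd n) eqn:E.
  - apply Z.div_str_pos; lia.
  (* An even positive integer is at least 2, so its half is positive. *)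
  - assert (n <> 1%Z) by (intros ->; discriminate).
    apply Z.div_str_pos; lia.
Qed.

Lemma iter_T5_pos (k : nat) (n : Z) : (0 < n)%Z -> (0 < Nat.iter k T5 n)%Z.
Proof.
  intros Hn; induction k as [|k IH]; simpl; [exact Hn | now apply T5_pos].
Qed.

Lemma T5_double (n : Z) : T5 (2 * n) = n.
Proof.
  unfold T5; rewrite Z.odd_mul; simpl Z.odd; cbv beta iota delta [andb].
  rewrite Z.mul_comm; apply Z.div_mul; lia.
Qed.

Lemma iter_T5_pow2 (k : nat) : Nat.iter k T5 (2 ^ Z.of_nat k)%Z = 1%Z.
Proof.
  induction k as [|k IH]; [reflexivity|].
  (* The first step of the orbit is split off, not the last: it is the one that halves 2^(k+1). *)
  rewrite Nat.iter_succ_r, Nat2Z.inj_succ, Z.pow_succ_r, T5_double by lia.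
  exact IH.
Qed.

(** [real] sends both infinities to 0, so they must be excluded: the bound [m] rules out minus
    infinity, the finite term [u 0] plus infinity. *)
Lemma Inf_seq_ge_real (u : nat -> R) (m : R) :
  (forall k, m <= u k)%R -> (m <= real (Inf_seq u))%R.
Proof.
  intros Hu.
  assert (Hm : Rbar_le m (Inf_seq u)).
  (* [m] is read as the infimum of a constant sequence, so that monotonicity of [Inf_seq]
     applies. *)
  { rewrite <- (is_inf_seq_unique (fun _ => Finite m) m).
    - now apply Inf_seq_le.
    - intros eps; destruct eps as [e He]; simpl.
      split; [intros _; lra | exists 0%nat; lra]. }
  pose proof (Inf_seq_correct u) as Hc.
  destruct (Inf_seq u) as [l| |]; simpl in *; [exact Hm | | contradiction].
  specialize (Hc (u 0%nat) 0%nat); simpl in Hc; lra.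
Qed.

(** The lower bound [m] keeps the infimum from being minus infinity, which [real] would turn into
    0. *)
Lemma real_Inf_seq_le (u : nat -> R) (m : R) (k : nat) :
  (forall j, m <= u j)%R -> (real (Inf_seq u) <= u k)%R.
Proof.
  intros Hu; pose proof (Inf_seq_correct u) as Hc.
  destruct (Inf_seq u) as [l| |]; simpl in *.
  - apply Rnot_lt_le; intros Hlt.
    (* With this gap as epsilon, l - epsilon < u k reads u k < u k. *)
    assert (He : (0 < l - u k)%R) by lra.
    destruct (Hc (mkposreal _ He)) as [H _].
    specialize (H k); simpl in H; lra.
  - specialize (Hc (u k) k); lra.
  - destruct (Hc m) as [j Hj]; specialize (Hu j); lra.
Qed.

Lemma abs_iter_T5_ge1 (n : Z) (k : nat) :
  (0 < n)%Z -> (1 <= IZR (Z.abs (Nat.iter k T5 n)))%R.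
Proof.
  intros Hn; apply IZR_le; pose proof (iter_T5_pos k n Hn); lia.
Qed.

Lemma tminus_ge1 (n : Z) : (0 < n)%Z -> (1 <= tminus n)%R.
Proof.
  intros Hn; apply Inf_seq_ge_real; intros k; now apply abs_iter_T5_ge1.
Qed.

Lemma tminus_pow2 (k : nat) : tminus (2 ^ Z.of_nat k)%Z = 1%R.
Proof.
  assert (Hpos : (0 < 2 ^ Z.of_nat k)%Z) by (apply Z.pow_pos_nonneg; lia).
  apply Rle_antisym; [|now apply tminus_ge1].
  replace 1%R with (IZR (Z.abs (Nat.iter k T5 (2 ^ Z.of_nat k)%Z)))
    by now rewrite iter_T5_pow2.
  apply (real_Inf_seq_le
           (fun j : nat => IZR (Z.abs (Nat.iter j T5 (2 ^ Z.of_nat k)%Z))) 1 k).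
  intros j; now apply abs_iter_T5_ge1.
Qed.

Theorem theorem7p4 :
  LimInf_seq (fun n : nat => (ln (tminus (Z.of_nat n)) / ln (INR n))%R)
  = Finite 0%R.
Proof.
  apply is_LimInf_seq_unique; intros [e He]; simpl; split.
  - intros N; exists (2 ^ N)%nat; split.
    + apply Nat.lt_le_incl, Nat.pow_gt_lin_r; lia.
    + rewrite Nat2Z.inj_pow; change (Z.of_nat 2) with 2%Z.
      rewrite tminus_pow2, ln_1; unfold Rdiv; rewrite Rmult_0_l; lra.
  (* From 2 on, the denominator is strictly positive. *)
  - exists 2%nat; intros n Hn.
    assert (Hnum : (0 <= ln (tminus (Z.of_nat n)))%R).
    { rewrite <- ln_1; apply ln_le; [lra | apply tminus_ge1; lia]. }
    assert (Hden : (0 < ln (INR n))%R).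
    { rewrite <- ln_1; apply ln_increasing; [lra|].
      apply (lt_INR 1); lia. }
    pose proof (Rdiv_le_0_compat _ _ Hnum Hden); lra.
Qed.
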